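(* Assume that the dual function $d$ (defined in the context) has a unique maximizer $\lambda^\ast$ over $\Pi$ and satisfies the locally-smooth assumption (stated in the context) with constants $S,L_{\mathrm s},D_{\mathrm s}>0$. For $V>0$ put $$B_{\mathrm s}(V)=\max\left\{\frac1{V^{1.5}},\frac{\sqrt V+\sqrt{V+4L_{\mathrm s}CV}}{2L_{\mathrm s}V}\right\},\qquad \mathcal R_{\mathrm s}(V)=\left\{\lambda\in\Pi:\|\lambda-\lambda^\ast\|\le B_{\mathrm s}(V)+\frac{\sqrt{2C}}V\right\}.$$ Let $V$ be sufficiently large and such that $B_{\mathrm s}(V)+\frac{\sqrt{2C}}V<S$. Let $\{x(t),y(t),w(t),z(t)\}_{t=0}^\infty$ be generated by the dual subgradient algorithm with parameter $V$ (described in the context), let $\lambda(t)=(w(t),z(t))$, let $T_{\mathrm s}=\inf\{t\ge0:\lambda(t)\in\mathcal R_{\mathrm s}(V)\}$ be the first iteration at which $\lambda(t)$ lies in $\mathcal R_{\mathrm s}(V)$, and for an integer $T>0$ let $\overline{x_{T_{\mathrm s}}}(T)=\frac1T\sum_{t=T_{\mathrm s}}^{T_{\mathrm s}+T-1}x(t)$. Then for every integer $T>0$, $$f(\overline{x_{T_{\mathrm s}}}(T))-f^{(\mathrm{opt})}\le\frac CV+\frac{2VM}{T}\left[\frac{\sqrt{2C}}V+B_{\mathrm s}(V)\right]+\frac{V}{2T}\left\{\left[\frac{\sqrt{2C}}V+B_{\mathrm s}(V)\right]^2+4\|\lambda^\ast\|\left[\frac{\sqrt{2C}}V+B_{\mathrm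 s}(V)\right]\right\},$$ and, for every $j\in\{1,\dots,J\}$, $$g_j(\overline{x_{T_{\mathrm s}}}(T))\le\frac{2V(1+M)}{T}\left[\frac{\sqrt{2C}}V+B_{\mathrm s}(V)\right].$$
   Context: Setting. $I,J$ are positive integers. $\mathcal X\subset\mathbb R^I$ is a nonempty closed bounded set (possibly non-convex or discrete) and $\overline{\mathcal X}$ is its convex hull. $\mathcal Y\subset\mathbb R^I$ is closed, bounded, convex and contains $\overline{\mathcal X}$. The functions $f,g_1,\dots,g_J:\mathcal Y\to\mathbb R$ are convex and Lipschitz continuous with a common constant $M>0$: $|f(x)-f(y)|\le M\|x-y\|$ and $|g_j(x)-g_j(y)|\le M\|x-y\|$ for all $x,y\in\mathcal Y$ (all norms are Euclidean). Write $g(y)=(g_1(y),\dots,g_J(y))$. $C>0$ is a constant with $\|g(y)\|^2\le C$ and $\|x-y\|^2\le C$ for all $x\in\overline{\mathcal X}$, $y\in\mathcal Y$. $f^{(\mathrm{opt})}$ is the optimal value of: minimize $f(x)$ subject to $g_j(x)\le 0$ for $j=1,\dots,J$ and $x\in\overline{\mathcal X}$. Dual function: $\Pi=\mathbb R_+^J\times\mathbb R^I$ with $\mathbb R_+=[0,\infty)$, and for $\lambda=(w,z)\in\Pi$, $d(\lambda)=d(w,z)=\inf_{x\in\overline{\mathcal X},\,y\in\mathcal Y}\left[f(y)+w^\top g(y)+z^\top(x-y)\right]$. Locally-smooth assumption with constants $S,L_{\mathrm s},D_{\mathrm s}>0$ (where $\lambda^\ast$ is the unique maximizer of $d$ over $\Pi$):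 (i) whenever $\lambda\in\Pi$ and $\|\lambda-\lambda^\ast\|\le S$, $d(\lambda^\ast)\ge d(\lambda)+L_{\mathrm s}\|\lambda-\lambda^\ast\|^2$; (ii) whenever $\lambda\in\Pi$ and $d(\lambda^\ast)-d(\lambda)\le D_{\mathrm s}$, $\|\lambda-\lambda^\ast\|\le S$. Dual subgradient algorithm with parameter $V>0$: start from any $w(0)\in\mathbb R_+^J$, $z(0)\in\mathbb R^I$. For $t=0,1,2,\dots$: choose $x(t)\in\mathcal X$ minimizing $x\mapsto z(t)^\top x$ over $\overline{\mathcal X}$; choose $y(t)\in\mathcal Y$ minimizing $y\mapsto f(y)+w(t)^\top g(y)-z(t)^\top y$ over $\mathcal Y$; set $w(t+1)=[w(t)+\frac1V g(y(t))]_+$ (componentwise positive part) and $z(t+1)=z(t)+\frac1V[x(t)-y(t)]$. ''$V$ sufficiently large'' means $V\ge V_0$ for some $V_0>0$ depending only on the problem data and constants above. *)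

(* Defs.v *)
From HB Require Import structures.
From mathcomp Require Export all_boot all_order all_algebra.
From mathcomp Require Export all_classical all_reals all_analysis.

Set Implicit Arguments.
Unset Strict Implicit.
Unset Printing Implicit Defensive.

Import Order.TTheory GRing.Theory Num.Theory.
Import numFieldNormedType.Exports.

Local Open Scope classical_set_scope.
Local Open Scope ring_scope.

Definition dot (R : realType) (n : nat) (u v : 'rV[R]_n) : R :=
  \sum_(i < n) u 0 i * v 0 i.

(* The library norm `|u| on 'rV[R]_n is the sup norm, hence this definition. *)
Definition enorm (R : realType) (n : nat) (u : 'rV[R]_n) : R :=
  Num.sqrt (dot u u).

Definition conv_hull (R : realType) (n : nat) (X : set 'rV[R]_n) :
    set 'rV[R]_n :=
  smallest (@convex_set R 'rV[R]_n) X.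

Definition pos_part (R : realType) (n : nat) (u : 'rV[R]_n) : 'rV[R]_n :=
  \row_j Num.max (u 0 j) 0.

Definition minimizes (R : realType) (T : Type) (h : T -> R) (A : set T)
    (a : T) : Prop :=
  A a /\ forall b, A b -> h a <= h b.

(* +oo when the problem is infeasible *)
Definition fopt (R : realType) (I J : nat) (X : set 'rV[R]_I)
    (f : 'rV[R]_I -> R) (g : 'rV[R]_I -> 'rV[R]_J) : \bar R :=
  ereal_inf [set (f x)%:E | x in
    [set x | conv_hull X x /\ forall j, g x 0 j <= 0]].

(* A dual vector (w, z) in R^J x R^I is the concatenation row_mx w z, so that
   its Euclidean norm is enorm (row_mx w z); w = lsubmx l and z = rsubmx l. *)
Definition Pi_set (R : realType) (I J : nat) : set 'rV[R]_(J + I) :=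
  [set l | forall j, 0 <= lsubmx l 0 j].

(* The infimum is over a nonempty set which is bounded below whenever X and Y
   are nonempty and compact, and f and g are Lipschitz on Y. *)
Definition dualf (R : realType) (I J : nat) (X Y : set 'rV[R]_I)
    (f : 'rV[R]_I -> R) (g : 'rV[R]_I -> 'rV[R]_J) (l : 'rV[R]_(J + I)) : R :=
  inf [set f y + dot (lsubmx l) (g y) + dot (rsubmx l) (x - y)
      | x in conv_hull X & y in Y].

Definition unique_maximizer (R : realType) (T : Type) (d : T -> R) (A : set T)
    (a : T) : Prop :=
  [/\ A a, forall b, A b -> d b <= d a
    & forall b, A b -> (forall c, A c -> d c <= d b) -> b = a].

Definition locally_smooth (R : realType) (I J : nat)
    (d : 'rV[R]_(J + I) -> R) (lstar : 'rV[R]_(J + I)) (S Ls Ds : R) : Prop :=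
  (forall l, @Pi_set R I J l -> enorm (l - lstar) <= S ->
     d lstar >= d l + Ls * enorm (l - lstar) ^+ 2) /\
  (forall l, @Pi_set R I J l -> d lstar - d l <= Ds ->
     enorm (l - lstar) <= S).

Definition dual_subgradient (R : realType) (I J : nat) (X Y : set 'rV[R]_I)
    (f : 'rV[R]_I -> R) (g : 'rV[R]_I -> 'rV[R]_J) (V : R)
    (x y : nat -> 'rV[R]_I) (w : nat -> 'rV[R]_J) (z : nat -> 'rV[R]_I) :
    Prop :=
  (forall j, 0 <= w 0%N 0 j) /\
  forall t : nat,
    [/\ X (x t) /\ minimizes (fun a => dot (z t) a) (conv_hull X) (x t),
        minimizes (fun b => f b + dot (w t) (g b) - dot (z t) b) Y (y t),
        w t.+1 = pos_part (w t + V^-1 *: g (y t))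
      & z t.+1 = z t + V^-1 *: (x t - y t)].

Definition Bs (R : realType) (Ls C V : R) : R :=
  Num.max (1 / (V `^ (3 / 2)))
    ((Num.sqrt V + Num.sqrt (V + 4 * Ls * C * V)) / (2 * Ls * V)).

Definition Rs (R : realType) (I J : nat) (lstar : 'rV[R]_(J + I))
    (Ls C V : R) : set 'rV[R]_(J + I) :=
  [set l | @Pi_set R I J l /\ enorm (l - lstar) <=
      Bs Ls C V + Num.sqrt (2 * C) / V].

Definition first_hitting (T : Type) (u : nat -> T) (A : set T) (t0 : nat) :
    Prop :=
  A (u t0) /\ forall t, (t < t0)%N -> ~ A (u t).

Definition avg_from (R : realType) (n : nat) (x : nat -> 'rV[R]_n)
    (Ts T : nat) : 'rV[R]_n :=
  (T%:R)^-1 *: \sum_(Ts <= t < Ts + T) x t.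

(* Main.v *)
(* The step direction gamma(t) = (g (y t), x t - y t) is a supergradient of the
   concave dual function d at lambda(t), so projecting onto Pi gives
     |lambda(t+1) - l|^2 <=
       |lambda(t) - l|^2 - (2/V) (d l - d (lambda(t))) + 2C/V^2   for l in Pi.
   Taking l = lambda(t) bounds one step by sqrt(2C)/V.  With l = lstar, once
   C/V < Ds, the dual gap exceeds C/V by a fixed margin outside the ball of
   radius Bs: inside the S-ball because Ls * Bs^2 > C/V, and outside it because
   the gap is then larger than Ds.  Hence the iterates reach Rs and never leave
   it.  Expanding |lambda(t+1)|^2 with the f (y t) part of d (lambda(t)) kept
   explicit, then summing and using weak duality and Jensen, bounds f at the
   average of y by the telescoped change of |lambda|^2; the constraints
   and the distance between the averages of x and y telescope to changes of w
   and z, all of which are controlled by the diameter of Rs. *)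
Require Import Defs.
From mathcomp Require Import ring lra.

Set Implicit Arguments.
Unset Strict Implicit.
Unset Printing Implicit Defensive.

Import Order.TTheory GRing.Theory Num.Theory.
Import numFieldNormedType.Exports.

Local Open Scope classical_set_scope.
Local Open Scope ring_scope.

(** * Euclidean inner product and norm on row vectors *)

Lemma dotC (R : realType) n (u v : 'rV[R]_n) : dot u v = dot v u.
Proof. by apply: eq_bigr => i _; rewrite mulrC. Qed.

Lemma dotDl (R : realType) n (u v a : 'rV[R]_n) :
  dot (u + v) a = dot u a + dot v a.
Proof.
by rewrite /dot -big_split; apply: eq_bigr => i _; rewrite mxE mulrDl.
Qed.

Lemma dotZl (R : realType) n k (u a : 'rV[R]_n) : dot (k *: u) a = k * dot u a.
Proof. by rewrite /dot mulr_sumr; apply: eq_bigr => i _; rewrite mxE mulrA. Qed.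

Lemma dotNl (R : realType) n (u a : 'rV[R]_n) : dot (- u) a = - dot u a.
Proof. by rewrite -scaleN1r dotZl mulN1r. Qed.

Lemma dotDr (R : realType) n (u v a : 'rV[R]_n) :
  dot a (u + v) = dot a u + dot a v.
Proof. by rewrite dotC dotDl !(dotC _ a). Qed.

Lemma dotZr (R : realType) n k (u a : 'rV[R]_n) : dot a (k *: u) = k * dot a u.
Proof. by rewrite dotC dotZl dotC. Qed.

Lemma dotNr (R : realType) n (u a : 'rV[R]_n) : dot a (- u) = - dot a u.
Proof. by rewrite dotC dotNl dotC. Qed.

Lemma dotr0 (R : realType) n (a : 'rV[R]_n) : dot a 0 = 0.
Proof. by rewrite -(scale0r 0) dotZr mul0r. Qed.

Definition dotE := (dotDl, dotDr, dotZl, dotZr, dotNl, dotNr).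

Lemma dot_ge0 (R : realType) n (u : 'rV[R]_n) : 0 <= dot u u.
Proof. by apply: sumr_ge0 => i _; rewrite -expr2 sqr_ge0. Qed.

Lemma dot_eq0 (R : realType) n (u : 'rV[R]_n) : dot u u = 0 -> u = 0.
Proof.
move=> u0; apply/rowP => i; rewrite mxE; apply/eqP.
have /eqP := u0; rewrite /dot psumr_eq0; last first.
  by move=> j _; rewrite -expr2 sqr_ge0.
by move=> /allP /(_ i (mem_index_enum _)); rewrite mulf_eq0 orbb.
Qed.

Lemma dot_row_mx (R : realType) m n (a c : 'rV[R]_m) (b d : 'rV[R]_n) :
  dot (row_mx a b) (row_mx c d) = dot a c + dot b d.
Proof.
by rewrite /dot big_split_ord; congr (_ + _); apply: eq_bigr => i _;
  rewrite ?row_mxEl ?row_mxEr.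
Qed.

Lemma dot_submx (R : realType) m n (u v : 'rV[R]_(m + n)) :
  dot u v = dot (lsubmx u) (lsubmx v) + dot (rsubmx u) (rsubmx v).
Proof. by rewrite -dot_row_mx !hsubmxK. Qed.

Lemma enorm_ge0 (R : realType) n (u : 'rV[R]_n) : 0 <= enorm u.
Proof. exact: sqrtr_ge0. Qed.

Lemma sqr_enorm (R : realType) n (u : 'rV[R]_n) : enorm u ^+ 2 = dot u u.
Proof. by rewrite sqr_sqrtr // dot_ge0. Qed.

Lemma enorm_le (R : realType) n (u : 'rV[R]_n) r :
  0 <= r -> (enorm u <= r) = (dot u u <= r ^+ 2).
Proof. by move=> r0; rewrite -sqr_enorm ler_pXn2r // nnegrE enorm_ge0. Qed.

Lemma enormZ (R : realType) n k (u : 'rV[R]_n) :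
  0 <= k -> enorm (k *: u) = k * enorm u.
Proof.
move=> k0; rewrite /enorm !dotE mulrA -expr2 sqrtrM ?sqr_ge0 //.
by rewrite sqrtr_sqr ger0_norm.
Qed.

Lemma enormB (R : realType) n (u v : 'rV[R]_n) : enorm (u - v) = enorm (v - u).
Proof. by rewrite /enorm; congr Num.sqrt; rewrite !dotE; ring. Qed.

Lemma dot_le_enorm (R : realType) n (u v : 'rV[R]_n) :
  dot u v <= enorm u * enorm v.
Proof.
have [v0|v0] := eqVneq v 0.
  by rewrite v0 dotr0 mulr_ge0 ?enorm_ge0.
apply: le_trans (ler_norm _) _.
rewrite -(@ler_pXn2r _ 2) ?nnegrE ?mulr_ge0 ?enorm_ge0 //.
rewrite real_normK ?num_real // exprMn !sqr_enorm.
have vv : 0 < dot v v.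
  by rewrite lt_neqAle dot_ge0 andbT eq_sym; apply: contra_neq v0 => /dot_eq0.
(* Cauchy-Schwarz: this squared norm factors as [dot v v] times [dot u u * dot v v - dot u v ^+ 2],
   and [dot v v] is positive. *)
have := dot_ge0 (dot v v *: u - dot u v *: v).
rewrite !dotE (dotC v u) => h.
rewrite -(ler_pM2l vv) -subr_ge0; apply: le_trans h _.
by rewrite le_eqVlt; apply/orP; left; apply/eqP; ring.
Qed.

Lemma enormD (R : realType) n (u v : 'rV[R]_n) :
  enorm (u + v) <= enorm u + enorm v.
Proof.
rewrite enorm_le ?addr_ge0 ?enorm_ge0 // !dotE (dotC v u) sqrrD !sqr_enorm.
have := dot_le_enorm u v; lra.
Qed.

Lemma enorm_triangle (R : realType) n (v u w : 'rV[R]_n) :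
  enorm (u - w) <= enorm (u - v) + enorm (v - w).
Proof. by apply: le_trans (enormD _ _); rewrite addrA subrK. Qed.

Lemma coord_le_enorm (R : realType) n (u : 'rV[R]_n) j : u 0 j <= enorm u.
Proof.
apply: le_trans (ler_norm _) _.
rewrite -(@ler_pXn2r _ 2) ?nnegrE ?enorm_ge0 // real_normK ?num_real //.
rewrite sqr_enorm /dot (bigD1 j) //= -expr2 lerDl.
by apply: sumr_ge0 => i _; rewrite -expr2 sqr_ge0.
Qed.

Lemma enorm_rsubmx (R : realType) m n (u : 'rV[R]_(m + n)) :
  enorm (rsubmx u) <= enorm u.
Proof.
by rewrite enorm_le ?enorm_ge0 // sqr_enorm (dot_submx u) lerDr dot_ge0.
Qed.

(* pos_part is the projection onto the nonnegative orthant. *)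
Lemma pos_part_nonexpansive (R : realType) n (u a : 'rV[R]_n) :
  (forall j, 0 <= a 0 j) ->
  dot (pos_part u - a) (pos_part u - a) <= dot (u - a) (u - a).
Proof.
move=> a0; apply: ler_sum => i _; rewrite !mxE.
by have := a0 i; case: (leP (u 0 i) 0) => u0; last lra; nra.
Qed.

(** * Window averages and Jensen's inequality *)

Lemma avg_fromS (R : realType) n (x : nat -> 'rV[R]_n) s T :
  (0 < T)%N ->
  avg_from x s T.+1 =
    T.+1%:R^-1 *: x (s + T)%N + (1 - T.+1%:R^-1) *: avg_from x s T.
Proof.
move=> T0; rewrite /avg_from addnS big_nat_recr ?leq_addr //= scalerDr addrC.
congr (_ + _); rewrite scalerA; congr (_ *: _).
have T0R : T%:R != 0 :> R by rewrite pnatr_eq0 -lt0n.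
by rewrite -natr1; field; rewrite T0R natr1 pnatr_eq0.
Qed.

Lemma avg_from1 (R : realType) n (x : nat -> 'rV[R]_n) s : avg_from x s 1 = x s.
Proof. by rewrite /avg_from addn1 big_nat1 invr1 scale1r. Qed.

Lemma invSn_le1 (R : realType) T : T.+1%:R^-1 <= 1 :> R.
Proof. by rewrite invf_le1 ?ltr0n // ler1n. Qed.

Lemma invSn_ge0 (R : realType) T : 0 <= T.+1%:R^-1 :> R.
Proof. by rewrite invr_ge0. Qed.

Lemma avg_from_convex (R : realType) n (A : set 'rV[R]_n) x s T :
  @convex_set R 'rV[R]_n A -> (forall t, A (x t)) -> (0 < T)%N ->
  A (avg_from x s T).
Proof.
(* The induction starts at one term: the empty average is 0, which need not lie in [A]. *)
move=> cA xA; case: T => // T _; elim: T => [|T IH].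
  by rewrite avg_from1.
have := cA _ _ (Itv01 (invSn_ge0 R T.+1) (invSn_le1 R T.+1))
  (mem_set (xA (s + T.+1)%N)) (mem_set IH).
by rewrite (avg_fromS x s (ltn0Sn T)) => /set_mem.
Qed.

(** Two-point convexity suffices: [avg_fromS] mixes the newest term, with weight 1/(T+1), into the
    previous average. *)
Lemma avg_from_jensen (R : realType) n (A : set 'rV[R]_n)
    (h : 'rV[R]_n -> R) x s T :
  @convex_set R 'rV[R]_n A -> @convex_function R 'rV[R]_n A h ->
  (forall t, A (x t)) -> (0 < T)%N ->
  h (avg_from x s T) <= T%:R^-1 * \sum_(s <= t < s + T) h (x t).
Proof.
move=> cA ch xA; case: T => // T _; elim: T => [|T IH].
  by rewrite avg_from1 addn1 big_nat1 invr1 mul1r.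
rewrite (avg_fromS x s (ltn0Sn T)).
apply: le_trans (ch (Itv01 (invSn_ge0 R T.+1) (invSn_le1 R T.+1)) _ _
  (mem_set (xA (s + T.+1)%N)) (mem_set (avg_from_convex s cA xA (ltn0Sn T)))) _.
rewrite convRE /= [in leRHS]addnS big_nat_recr ?leq_addr //= mulrDr.
rewrite [leRHS]addrC lerD2l.
apply: le_trans (ler_wpM2l _ IH) _; first by rewrite subr_ge0 invSn_le1.
rewrite le_eqVlt; apply/orP; left; apply/eqP; rewrite mulrA; congr (_ * _).
by rewrite /unstable.onem -[in T.+2%:R]natr1; field;
  rewrite nat1r natr1 !pnatr_eq0.
Qed.

(** * Reaching a ball and staying in it *)

(** Above [B] the square loses at least [e] per step, so [D] cannot stay above [B + s]. Afterwards a
    step from at most [B] gains at most [s], and a step from between [B] and [B + s] does not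
    increase [D]. *)
Lemma hitting_time (R : realType) (D : nat -> R) (B s e : R) :
  0 <= s -> 0 < e -> (forall t, 0 <= D t) ->
  (forall t, D t.+1 <= D t + s) ->
  (forall t, B < D t -> D t.+1 ^+ 2 <= D t ^+ 2 - e) ->
  exists t0, [/\ D t0 <= B + s, forall t, (t < t0)%N -> B + s < D t
    & forall t, D (t0 + t)%N <= B + s].
Proof.
move=> s0 e0 D0 Ds De.
have ex : exists t, D t <= B + s.
  apply: contrapT => /forallNP nD.
  have lin t : D t ^+ 2 <= D 0%N ^+ 2 - e * t%:R.
    elim: t => [|t IH]; first by rewrite mulr0 subr0.
    have Bt : B < D t by have /negP := nD t; rewrite -ltNge; lra.
    by have := De t Bt; rewrite -natr1; lra.
  (* An integer [N] above [D 0 ^+ 2 / e] would make [D N ^+ 2] negative. *)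
  have := archi_boundP (divr_ge0 (sqr_ge0 (D 0%N)) (ltW e0)).
  set N := Num.bound _; rewrite ltr_pdivrMr // => hN.
  by have := lin N; have := sqr_ge0 (D N); lra.
case: (ex_minnP ex) => t0 ht0 hmin; exists t0; split=> //.
  by move=> t tt0; rewrite ltNge; apply/negP => /hmin; rewrite leqNgt tt0.
elim=> [|t IH]; first by rewrite addn0.
rewrite addnS; have [le|lt] := leP (D (t0 + t)%N) B.
  by apply: le_trans (Ds _) _; rewrite lerD2r.
apply: le_trans IH; rewrite -(@ler_pXn2r _ 2) ?nnegrE ?D0 //.
by apply: le_trans (De _ lt) _; rewrite gerBl ltW.
Qed.

(** * The dual function, its supergradients and one step of the algorithm *)

Section Dual.
Context (R : realType) (I J : nat) (X Y : set 'rV[R]_I)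
  (f : 'rV[R]_I -> R) (g : 'rV[R]_I -> 'rV[R]_J) (M C : R).
Hypothesis M_ge0 : 0 <= M.
Hypothesis C_ge0 : 0 <= C.
Hypothesis hXY : conv_hull X `<=` Y.
Hypothesis hfM : forall a b, Y a -> Y b -> `|f a - f b| <= M * enorm (a - b).
Hypothesis hgC : forall b, Y b -> enorm (g b) ^+ 2 <= C.
Hypothesis hxyC : forall a b, conv_hull X a -> Y b -> enorm (a - b) ^+ 2 <= C.

Let enorm_g b : Y b -> enorm (g b) <= Num.sqrt C.
Proof.
by move=> Yb; rewrite enorm_le ?sqrtr_ge0 // sqr_sqrtr // -sqr_enorm hgC.
Qed.

Let enorm_xy a b : conv_hull X a -> Y b -> enorm (a - b) <= Num.sqrt C.
Proof.
move=> Xa Yb.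
by rewrite enorm_le ?sqrtr_ge0 // sqr_sqrtr // -sqr_enorm hxyC.
Qed.

Let dot_ge_enorm n (u v : 'rV[R]_n) k :
  enorm v <= k -> - (enorm u * k) <= dot u v.
Proof.
move=> vk; rewrite lerNl -dotNl; apply: le_trans (dot_le_enorm _ _) _.
have -> : enorm (- u) = enorm u by rewrite -[- u]sub0r enormB subr0.
by rewrite ler_wpM2l ?enorm_ge0.
Qed.

Lemma dualf_le l a b : conv_hull X a -> Y b ->
  dualf X Y f g l <= f b + dot (lsubmx l) (g b) + dot (rsubmx l) (a - b).
Proof.
move=> Xa Yb; apply: ge_inf; last by exists a => //; exists b.
set K := Num.sqrt C.
(* The real-valued [inf] is a lower bound only for a set bounded below. Here the Lipschitz bound
   compares [f] with [f a], and Cauchy-Schwarz bounds both inner products. *)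
exists (f a - M * K - enorm (lsubmx l) * K - enorm (rsubmx l) * K).
move=> _ [c Xc [y Yy <-]].
have := dot_ge_enorm (lsubmx l) (enorm_g Yy).
have := dot_ge_enorm (rsubmx l) (enorm_xy Xc Yy).
have := hfM (hXY Xa) Yy; rewrite ler_norml => /andP[_ h1].
have h2 : M * enorm (a - y) <= M * K by rewrite ler_wpM2l ?enorm_xy.
by rewrite -/K; lra.
Qed.

(** Weak duality: at the pair [(a, a)] the coupling term vanishes and the multiplier term is
    nonpositive. *)
Lemma dualf_le_feasible l a : @Pi_set R I J l -> conv_hull X a ->
  (forall j, g a 0 j <= 0) -> dualf X Y f g l <= f a.
Proof.
move=> l0 Xa ga; apply: le_trans (dualf_le l Xa (hXY Xa)) _.
rewrite subrr dotr0 addr0 gerDl; apply: sumr_le0 => j _.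
by rewrite mulr_ge0_le0 ?l0 ?ga.
Qed.

(** The Lagrangian separates in its two primal variables, so separate minimizers minimize it
    jointly. *)
Lemma dualf_ge_minimizer w z x y :
  minimizes (fun a => dot z a) (conv_hull X) x ->
  minimizes (fun b => f b + dot w (g b) - dot z b) Y y ->
  f y + dot w (g y) + dot z (x - y) <= dualf X Y f g (row_mx w z).
Proof.
move=> [Xx hx] [Yy hy]; apply: lb_le_inf.
  by exists (f y + dot (lsubmx (row_mx w z)) (g y)
             + dot (rsubmx (row_mx w z)) (x - y)), x => //; exists y.
move=> _ [a Xa [b Yb <-]]; rewrite row_mxKl row_mxKr.
by have := hx a Xa; have := hy b Yb; rewrite !dotE; lra.
Qed.

(** The Lagrangian at the fixed pair [(x, y)] is linear in the multipliers up to the constant [f y];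
    it lies above the dual function and touches it at [row_mx w z]. *)
Lemma dot_subgradient_le w z x y l :
  minimizes (fun a => dot z a) (conv_hull X) x ->
  minimizes (fun b => f b + dot w (g b) - dot z b) Y y ->
  dot (row_mx (g y) (x - y)) (row_mx w z - l) <=
    dualf X Y f g (row_mx w z) - dualf X Y f g l.
Proof.
move=> hx hy; have := dualf_ge_minimizer hx hy.
have := dualf_le l hx.1 hy.1.
have -> : dot (row_mx (g y) (x - y)) (row_mx w z - l) =
    dot w (g y) + dot z (x - y)
    - (dot (lsubmx l) (g y) + dot (rsubmx l) (x - y)).
  rewrite dotDr dotNr dot_row_mx [dot _ l]dot_submx row_mxKl row_mxKr.
  by rewrite !(dotC (g y)) !(dotC (x - y)).
by lra.
Qed.

(** Only the [w] block is projected, which brings it no farther from [lsubmx l]; expanding the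
    squares leaves a second-order term of at most [C + C] over V^2. *)
Lemma drift w z x y V l :
  conv_hull X x -> Y y -> @Pi_set R I J l ->
  enorm (row_mx (pos_part (w + V^-1 *: g y)) (z + V^-1 *: (x - y)) - l) ^+ 2 <=
  enorm (row_mx w z - l) ^+ 2
    + 2 / V * dot (row_mx (g y) (x - y)) (row_mx w z - l) + 2 * C / V ^+ 2.
Proof.
move=> Xx Yy l0; rewrite -[l]hsubmxK.
set a := lsubmx l; set b := rsubmx l.
rewrite !sqr_enorm !opp_row_mx !add_row_mx !dot_row_mx.
have h1 := pos_part_nonexpansive (w + V^-1 *: g y) l0.
have h2 := hgC Yy; have h3 := hxyC Xx Yy; rewrite !sqr_enorm in h2 h3.
apply: le_trans (lerD h1 (lexx _)) _; rewrite -/a.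
have -> : 2 * C / V ^+ 2 = V^-1 ^+ 2 * (C + C) by rewrite exprVn; ring.
have h4 : V^-1 ^+ 2 * (dot (g y) (g y) + dot (x - y) (x - y)) <=
    V^-1 ^+ 2 * (C + C).
  by rewrite ler_wpM2l ?sqr_ge0 // lerD.
apply: le_trans (lerD (lexx _) h4).
rewrite -/b; move: (g y) (x - y) {l0 h1 h2 h3 h4} => u v; move: a b => a b.
rewrite !dotE (dotC a w) (dotC u w) (dotC a u) (dotC b z) (dotC v z) (dotC b v).
by rewrite le_eqVlt; apply/orP; left; apply/eqP; ring.
Qed.

(** * Estimates along a run of the algorithm *)

Section Run.
Context (V : R) (x y : nat -> 'rV[R]_I) (w : nat -> 'rV[R]_J)
  (z : nat -> 'rV[R]_I).
Hypothesis V_gt0 : 0 < V.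
Hypothesis run : dual_subgradient X Y f g V x y w z.

Local Notation lam t := (row_mx (w t) (z t)).
Local Notation d := (dualf X Y f g).

Let Xx t : conv_hull X (x t).
Proof. by have [[_ []]] := run.2 t. Qed.

Let Yy t : Y (y t).
Proof. by have [_ []] := run.2 t. Qed.

Lemma Pi_set_iterate t : @Pi_set R I J (lam t).
Proof.
move=> j; rewrite row_mxKl; case: t => [|t]; first exact: run.1.
by have [_ _ -> _] := run.2 t; rewrite mxE le_max lexx orbT.
Qed.

Lemma iterate_drift t l : @Pi_set R I J l ->
  enorm (lam t.+1 - l) ^+ 2 <=
  enorm (lam t - l) ^+ 2 + 2 / V * (d (lam t) - d l) + 2 * C / V ^+ 2.
Proof.
move=> l0; have [[_ hx] hy hw hz] := run.2 t.
have := drift (w t) (z t) V (Xx t) (Yy t) l0; rewrite -hw -hz => /le_trans.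
apply; rewrite lerD2r lerD2l ler_pM2l ?divr_gt0 //.
exact: dot_subgradient_le.
Qed.

Lemma iterate_step t : enorm (lam t.+1 - lam t) <= Num.sqrt (2 * C) / V.
Proof.
have s0 : 0 <= Num.sqrt (2 * C) / V by rewrite divr_ge0 ?sqrtr_ge0 ?ltW.
have := iterate_drift t (Pi_set_iterate t).
rewrite enorm_le // sqr_enorm => /le_trans; apply.
rewrite !subrr mulr0 addr0 sqr_enorm dotr0 add0r.
by rewrite exprMn exprVn sqr_sqrtr ?mulr_ge0.
Qed.

(** This is [drift] at [l = 0], scaled by V/2: the inner product is then the Lagrangian value minus
    [f (y t)], and the former is at most the dual value. *)
Lemma iterate_objective t :
  f (y t) <= d (lam t) + C / V
    + V / 2 * (enorm (lam t) ^+ 2 - enorm (lam t.+1) ^+ 2).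
Proof.
have [[_ hx] hy hw hz] := run.2 t.
have Pi0 : @Pi_set R I J 0 by move=> j; rewrite linear0 mxE.
have := drift (w t) (z t) V (Xx t) (Yy t) Pi0; rewrite -hw -hz !subr0.
have := dualf_ge_minimizer hx hy.
rewrite dot_row_mx (dotC (g _)) (dotC (x t - y t)).
move: (dot _ _) (dot _ _) => q p h1 h2.
have h3 : V / 2 * enorm (lam t.+1) ^+ 2 <=
    V / 2 * enorm (lam t) ^+ 2 + (p + q) + C / V.
  have Vn0 : V != 0 by rewrite gt_eqF.
  have -> : V / 2 * enorm (lam t) ^+ 2 + (p + q) + C / V = V / 2 *
      (enorm (lam t) ^+ 2 + 2 / V * (p + q) + 2 * C / V ^+ 2) by field.
  by rewrite ler_pM2l ?divr_gt0.
by lra.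
Qed.

Hypothesis hYconv : @convex_set R 'rV[R]_I Y.
Hypothesis hfconv : @convex_function R 'rV[R]_I Y f.
Hypothesis hgconv :
  forall j : 'I_J, @convex_function R 'rV[R]_I Y (fun b => g b 0 j).
Hypothesis hgM : forall (j : 'I_J) a b, Y a -> Y b ->
  `|g a 0 j - g b 0 j| <= M * enorm (a - b).

(** * Averages over the [T] iterations starting at [s] *)

Section Average.
Context (s T : nat) (T_gt0 : (0 < T)%N).

Let TR : 0 < T%:R :> R. Proof. by rewrite ltr0n. Qed.

(** Each difference [x t - y t] is [V] times an increment of [z], so the sum telescopes. *)
Lemma enorm_avg_gap :
  enorm (avg_from x s T - avg_from y s T) =
  V / T%:R * enorm (z (s + T)%N - z s).
Proof.
rewrite -enormZ ?divr_ge0 ?ltW //; congr enorm.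
rewrite /avg_from -scalerBr -sumrB mulrC -scalerA; congr (_ *: _).
rewrite -(telescope_sumr _ (leq_addr T s)) scaler_sumr; apply: eq_bigr => t _.
have [_ _ _ ->] := run.2 t.
by rewrite [z t + _]addrC addrK scalerA divff ?scale1r ?gt_eqF.
Qed.

Let Yavg u : (forall t, Y (u t)) -> Y (avg_from u s T).
Proof. by move=> Yu; apply: avg_from_convex. Qed.

Let Yx t : Y (x t). Proof. exact: hXY. Qed.

(** Jensen is applied to the [y t], whose objective is controlled; the Lipschitz bound then passes
    to the average of [x]. Allowing any upper bound [v] of the dual avoids strong duality. *)
Lemma avg_objective v : (forall l, @Pi_set R I J l -> d l <= v) ->
  f (avg_from x s T) <= v + C / V
    + V / (2 * T%:R) * (enorm (lam s) ^+ 2 - enorm (lam (s + T)) ^+ 2)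
    + V * M / T%:R * enorm (z (s + T)%N - z s).
Proof.
move=> dv.
have := hfM (Yavg Yx) (Yavg Yy); rewrite enorm_avg_gap ler_norml => /andP[_ h1].
have h2 := avg_from_jensen s hYconv hfconv Yy T_gt0.
have h3 : \sum_(s <= t < s + T) f (y t) <= (v + C / V) * T%:R
    + V / 2 * (enorm (lam s) ^+ 2 - enorm (lam (s + T)) ^+ 2).
  have -> : (v + C / V) * T%:R = \sum_(s <= t < s + T) (v + C / V).
    by rewrite sumr_const_nat addKn mulr_natr.
  rewrite -[_ - enorm (lam (s + T)) ^+ 2]opprB.
  rewrite -(telescope_sumr (fun t => enorm (lam t) ^+ 2) (leq_addr T s)).
  rewrite -sumrN mulr_sumr -big_split /=; apply: ler_sum => t _.
  rewrite opprB; apply: le_trans (iterate_objective t) _.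
  by rewrite !lerD2r dv //; exact: Pi_set_iterate.
have h4 : T%:R^-1 * \sum_(s <= t < s + T) f (y t) <= v + C / V
    + V / (2 * T%:R) * (enorm (lam s) ^+ 2 - enorm (lam (s + T)) ^+ 2).
  rewrite mulrC ler_pdivrMr //; apply: le_trans h3 _.
  rewrite le_eqVlt; apply/orP; left; apply/eqP.
  by field; rewrite !gt_eqF.
have -> : V * M / T%:R * enorm (z (s + T)%N - z s) =
  M * (V / T%:R * enorm (z (s + T)%N - z s)) by ring.
by lra.
Qed.

Lemma avg_constraint j :
  g (avg_from x s T) 0 j <=
    V / T%:R * (w (s + T)%N 0 j - w s 0 j)
    + V * M / T%:R * enorm (z (s + T)%N - z s).
Proof.
have := hgM j (Yavg Yx) (Yavg Yy).
rewrite enorm_avg_gap ler_norml => /andP[_ h1].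
have h2 := avg_from_jensen s hYconv (hgconv j) Yy T_gt0.
have h3 : \sum_(s <= t < s + T) g (y t) 0 j <= V * (w (s + T)%N 0 j - w s 0 j).
  rewrite -(telescope_sumr (fun t => w t 0 j) (leq_addr T s)) mulr_sumr.
  apply: ler_sum => t _; have [_ _ -> _] := run.2 t.
  (* The positive part can only raise a coordinate, so the increment of [w] is at least
     g_j(y(t))/V. *)
  rewrite !mxE -ler_pdivrMl // lerBrDl le_max lexx //.
have h4 : T%:R^-1 * \sum_(s <= t < s + T) g (y t) 0 j <=
    V / T%:R * (w (s + T)%N 0 j - w s 0 j).
  by rewrite [V / _]mulrC -mulrA ler_pM2l ?invr_gt0.
have -> : V * M / T%:R * enorm (z (s + T)%N - z s) =
  M * (V / T%:R * enorm (z (s + T)%N - z s)) by ring.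
by rewrite /= in h2; lra.
Qed.

End Average.
End Run.
End Dual.

(** * Estimates on the ball radius and on the optimal value *)

(** Expanding both squares around [c] leaves the cross term [2 * dot c (u - v)], where [u - v] has
    norm at most [2 * r]; the term in [v - c] has a favourable sign. *)
Lemma sqr_enorm_sub_le (R : realType) n (u v c : 'rV[R]_n) r :
  enorm (u - c) <= r -> enorm (v - c) <= r ->
  enorm u ^+ 2 - enorm v ^+ 2 <= r ^+ 2 + 4 * enorm c * r.
Proof.
move=> hu hv.
have r0 : 0 <= r by apply: le_trans (enorm_ge0 _) hu.
have h1 : enorm (u - c) ^+ 2 <= r ^+ 2.
  by rewrite ler_pXn2r // nnegrE enorm_ge0.
have h2 : dot c (u - v) <= enorm c * (r + r).
  apply: le_trans (dot_le_enorm _ _) _; rewrite ler_wpM2l ?enorm_ge0 //.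
  by apply: le_trans (enorm_triangle c u v) _; rewrite lerD // enormB.
have h3 := dot_ge0 (v - c).
suff : enorm u ^+ 2 - enorm v ^+ 2 =
    enorm (u - c) ^+ 2 - dot (v - c) (v - c) + 2 * dot c (u - v) by lra.
by rewrite !sqr_enorm !dotE (dotC u c) (dotC v c); ring.
Qed.

Lemma Bs_gt0 (R : realType) (Ls C V : R) : 0 < V -> 0 < Bs Ls C V.
Proof. by move=> V0; rewrite /Bs lt_max divr_gt0 // powR_gt0. Qed.

(* The second term in the definition of Bs is the positive root b of
   Ls * V * b ^ 2 = Num.sqrt V * b + C. *)
Lemma Bs_sqr_gt (R : realType) (Ls C V : R) : 0 < Ls -> 0 < C -> 0 < V ->
  C / V < Ls * Bs Ls C V ^+ 2.
Proof.
move=> Ls0 C0 V0.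
set q := Num.sqrt V + Num.sqrt (V + 4 * Ls * C * V).
have LV : 0 < 2 * Ls * V by rewrite !mulr_gt0.
have q0 : 0 <= q by rewrite addr_ge0 ?sqrtr_ge0.
have qB : q / (2 * Ls * V) <= Bs Ls C V by rewrite /Bs le_max lexx orbT.
apply: (@lt_le_trans _ _ (Ls * (q / (2 * Ls * V)) ^+ 2)); last first.
  rewrite ler_pM2l // ler_pXn2r // nnegrE ?divr_ge0 // ltW //.
  exact: Bs_gt0.
have -> : Ls * (q / (2 * Ls * V)) ^+ 2 = q ^+ 2 / (4 * Ls * V) / V.
  by field; rewrite !gt_eqF.
rewrite ltr_pM2r ?invr_gt0 // ltr_pdivlMr ?mulr_gt0 //.
have LCV : 0 <= 4 * Ls * C * V by rewrite !mulr_ge0 // ltW.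
(* The square of [q] is 4 Ls C V plus 2V plus twice a product of square roots; the term 2V makes the
   inequality strict. *)
rewrite sqrrD !sqr_sqrtr ?addr_ge0 ?(ltW V0) //.
have := mulr_ge0 (sqrtr_ge0 V) (sqrtr_ge0 (V + 4 * Ls * C * V)); lra.
Qed.

(** Reduces the bound against [fopt] to one feasible point at a time; for an empty feasible set the
    left side is -oo. *)
Lemma sub_ereal_inf_le (R : realType) (A : set \bar R) (a k : R) :
  (forall v, A v -> (a - k)%:E <= v)%E -> (a%:E - ereal_inf A <= k%:E)%E.
Proof.
move=> /ereal_infP; case: (ereal_inf A) => [r| |] //=.
- by rewrite -EFinB !lee_fin; lra.
- by rewrite leNye.
Qed.

(** * Hitting time of [Rs] and bounds on the averaged iterates *)

Theorem theorem3 (R : realType) (I J : nat) (hI : (0 < I)%N) (hJ : (0 < J)%N)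
  (X Y : set 'rV[R]_I)
  (hX0 : X !=set0) (hXc : closed X) (hXb : bounded_set X)
  (hYc : closed Y) (hYb : bounded_set Y) (hYconv : @convex_set R 'rV[R]_I Y)
  (hXY : conv_hull X `<=` Y)
  (f : 'rV[R]_I -> R) (g : 'rV[R]_I -> 'rV[R]_J)
  (hfconv : @convex_function R 'rV[R]_I Y f)
  (hgconv : forall j : 'I_J, @convex_function R 'rV[R]_I Y (fun y => g y 0 j))
  (M : R) (hM : 0 < M)
  (hfM : forall a b, Y a -> Y b -> `|f a - f b| <= M * enorm (a - b))
  (hgM : forall (j : 'I_J) a b, Y a -> Y b ->
    `|g a 0 j - g b 0 j| <= M * enorm (a - b))
  (C : R) (hC : 0 < C)
  (hgC : forall b, Y b -> enorm (g b) ^+ 2 <= C)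
  (hxyC : forall a b, conv_hull X a -> Y b -> enorm (a - b) ^+ 2 <= C)
  (lstar : 'rV[R]_(J + I))
  (hstar : unique_maximizer (dualf X Y f g) (@Pi_set R I J) lstar)
  (S Ls Ds : R) (hS : 0 < S) (hLs : 0 < Ls) (hDs : 0 < Ds)
  (hsmooth : locally_smooth (dualf X Y f g) lstar S Ls Ds) :
  exists V0 : R, 0 < V0 /\
    forall V : R, V0 <= V -> Bs Ls C V + Num.sqrt (2 * C) / V < S ->
    forall (x y : nat -> 'rV[R]_I) (w : nat -> 'rV[R]_J) (z : nat -> 'rV[R]_I),
    dual_subgradient X Y f g V x y w z ->
    exists Ts : nat,
      first_hitting (fun t => row_mx (w t) (z t)) (Rs lstar Ls C V) Ts /\
      forall T : nat, (0 < T)%N ->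
        ((f (avg_from x Ts T))%:E - fopt X f g <=
          (C / V
           + 2 * V * M / T%:R * (Num.sqrt (2 * C) / V + Bs Ls C V)
           + V / (2 * T%:R) *
             ((Num.sqrt (2 * C) / V + Bs Ls C V) ^+ 2
              + 4 * enorm lstar * (Num.sqrt (2 * C) / V + Bs Ls C V)))%:E)%E
        /\
        forall j : 'I_J,
          g (avg_from x Ts T) 0 j <=
            2 * V * (1 + M) / T%:R * (Num.sqrt (2 * C) / V + Bs Ls C V).
Proof.
have C0 := ltW hC; have M0 := ltW hM.
(* This threshold gives C/V at most Ds/2, hence a positive margin below [Ds]. *)
exists (2 * C / Ds); split; first by rewrite !mulr_gt0 ?invr_gt0.
move=> V V0V _ x y w z run.
have V0 : 0 < V by apply: lt_le_trans V0V; rewrite !mulr_gt0 ?invr_gt0.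
set B := Bs Ls C V; set s := Num.sqrt (2 * C) / V.
have s0 : 0 <= s by rewrite divr_ge0 ?sqrtr_ge0 // ltW.
have B0 : 0 < B by exact: Bs_gt0.
pose lam t := row_mx (w t) (z t).
pose d := dualf X Y f g.
have [Pistar dmax _] := hstar.
have Pilam t : @Pi_set R I J (lam t) by exact: (Pi_set_iterate run).
have CVDs : C / V < Ds.
  rewrite ltr_pdivrMr //; move: V0V; rewrite ler_pdivrMr // [V * _]mulrC.
  by move: (Ds * V) => p; lra.
have CVB : C / V < Ls * B ^+ 2 by exact: Bs_sqr_gt.
(* The drift towards [lstar] is -2/V times the dual gap plus 2C/V^2; [e] is the net decrease when
   the gap is at least the minimum. *)
set e := 2 / V * (Num.min (Ls * B ^+ 2) Ds - C / V).
have e0 : 0 < e by rewrite mulr_gt0 ?divr_gt0 // subr_gt0 lt_min CVB.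
have outside t : B < enorm (lam t - lstar) ->
    enorm (lam t.+1 - lstar) ^+ 2 <= enorm (lam t - lstar) ^+ 2 - e.
  move=> Bt; apply: le_trans
    (iterate_drift M0 C0 hXY hfM hgC hxyC V0 run t Pistar) _.
  rewrite -/(lam t) -/d.
  suff gap : Num.min (Ls * B ^+ 2) Ds <= d lstar - d (lam t).
    have -> : 2 * C / V ^+ 2 = 2 / V * (C / V) by field; rewrite gt_eqF.
    rewrite -addrA lerD2l -mulrDr -mulrN ler_pM2l ?divr_gt0 //.
    by move: gap; move: (Num.min _ _) (C / V) => p q; lra.
  rewrite ge_min; have [Slam|lamS] := leP (enorm (lam t - lstar)) S.
    apply/orP; left.
    have h1 := hsmooth.1 _ (Pilam t) Slam.
    have h2 : Ls * B ^+ 2 <= Ls * enorm (lam t - lstar) ^+ 2.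
      by rewrite ler_pM2l // ler_pXn2r ?nnegrE ?enorm_ge0 // ltW.
    by rewrite /d; lra.
  apply/orP; right; apply/ltW; rewrite ltNge; apply/negP => h.
  by have := hsmooth.2 _ (Pilam t) h; rewrite leNgt lamS.
have step t : enorm (lam t.+1 - lstar) <= enorm (lam t - lstar) + s.
  apply: le_trans (enorm_triangle (lam t) _ _) _; rewrite addrC lerD2l.
  exact: (iterate_step M0 C0 hXY hfM hgC hxyC V0 run).
have [Ts [hTs before after]] :=
  hitting_time s0 e0 (fun t => enorm_ge0 (lam t - lstar)) step outside.
exists Ts; split.
  split; first by split; [exact: Pilam|exact: hTs].
  by move=> t tTs [_]; rewrite leNgt before.
move=> T T0; rewrite [s + B]addrC; set r := B + s.
have TR : 0 < T%:R :> R by rewrite ltr0n.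
have r0 : 0 <= r by rewrite addr_ge0 // ltW.
have hT := after T.
(* Both iterates lie in the ball of radius [r] around [lstar]; its diameter is the source of the
   factor 2 in the terms with [M] and in the constraint bound. *)
have lamgap : enorm (lam (Ts + T)%N - lam Ts) <= 2 * r.
  apply: le_trans (enorm_triangle lstar _ _) _.
  by rewrite [enorm (lstar - _)]enormB mulr_natl mulr2n lerD.
have zgap : enorm (z (Ts + T)%N - z Ts) <= 2 * r.
  apply: le_trans lamgap; apply: le_trans (enorm_rsubmx _).
  by rewrite opp_row_mx add_row_mx row_mxKr.
have zgap' : V * M / T%:R * enorm (z (Ts + T)%N - z Ts) <=
    2 * V * M / T%:R * r.
  have -> : 2 * V * M / T%:R * r = V * M / T%:R * (2 * r) by ring.
  by rewrite ler_wpM2l // divr_ge0 ?mulr_ge0 // ltW.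
split.
  apply: sub_ereal_inf_le => _ [a [Xa ga] <-]; rewrite lee_fin.
  (* Weak duality lets the value at each feasible [a] serve as [v] in [avg_objective]. *)
  have dfa l : @Pi_set R I J l -> dualf X Y f g l <= f a.
    by move=> l0; apply: (dualf_le_feasible M0 C0 hXY hfM hgC hxyC).
  have := avg_objective hXY hfM hgC hxyC V0 run hYconv hfconv Ts T0 dfa.
  have h : V / (2 * T%:R) *
      (enorm (lam Ts) ^+ 2 - enorm (lam (Ts + T)%N) ^+ 2) <=
      V / (2 * T%:R) * (r ^+ 2 + 4 * enorm lstar * r).
    rewrite ler_wpM2l ?divr_ge0 ?mulr_ge0 ?(ltW V0) //.
    exact: sqr_enorm_sub_le.
  by move: h; rewrite /lam; lra.
move=> j.
have := avg_constraint hXY V0 run hYconv hgconv hgM Ts T0 j.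
have wgap : V / T%:R * (w (Ts + T)%N 0 j - w Ts 0 j) <= V / T%:R * (2 * r).
  rewrite ler_wpM2l ?divr_ge0 ?(ltW V0) //.
  apply: le_trans lamgap; apply: le_trans (coord_le_enorm _ (lshift I j)).
  by rewrite opp_row_mx add_row_mx row_mxEl !mxE.
have -> : 2 * V * (1 + M) / T%:R * r =
  V / T%:R * (2 * r) + 2 * V * M / T%:R * r by ring.
by move: zgap' wgap; lra.
Qed.
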